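(* Let $\Gamma$ be a torsion-free, finitely generated nilpotent group with Hirsch length at least $2$, and let $\alpha\in\operatorname{Hom}(\Gamma,\mathbb{Z})$ be the canonical homomorphism with respect to some Mal'cev basis of $\Gamma$. Then there is a cohomology class $[\sigma]\in H^2(\Gamma)$ that is skinny with respect to $\alpha$ and is not a torsion element of $H^2(\Gamma)$.
   Context: $H^2(\Gamma)$ denotes the second group cohomology of $\Gamma$ with coefficients in $\mathbb{Z}$ with trivial action. A Mal'cev basis of a torsion-free finitely generated nilpotent group $\Gamma$ is a tuple $(a_1,\dots,a_m)\in\Gamma^m$ such that every $g\in\Gamma$ can be written uniquely as $g=a_1^{x_1}\cdots a_m^{x_m}$ with $(x_1,\dots,x_m)\in\mathbb{Z}^m$, and the subgroups $\Gamma_i=\langle a_i,\dots,a_m\rangle$ form a central series for $\Gamma$ (i.e. $[\Gamma,\Gamma_i]\subseteq\Gamma_{i+1}$, with $\Gamma_{m+1}=\{e\}$). The number $m$ is independent of the choice of Mal'cev basis and is the Hirsch length of $\Gamma$. The canonical homomorphism with respect to $(a_1,\dots,a_m)$ is $\alpha:\Gamma\to\mathbb{Z}$, $\alpha(a_1^{x_1}\cdots a_m^{x_m})=x_1$. For a group $\Gamma$, $\alpha\in\operatorname{Hom}(\Gamma,\mathbb{Z})$, and $\kappa_\alpha:\ker(\alpha)\to\Gamma$ the inclusion, a class $[\sigma]\in H^2(\Gamma)$ is called skinny with respect to $\alpha$ if $\kappa_\alpha^*([\sigma])=0$ in $H^2(\ker(\alpha))$. *)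

(* Defs.v *)
From HB Require Import structures.
From mathcomp Require Import all_boot all_order all_algebra.
From mathcomp Require Import ring.
From mathcomp Require Import boolp classical_sets functions.

Set Implicit Arguments.
Unset Strict Implicit.
Unset Printing Implicit Defensive.

Import GRing.Theory.
Local Open Scope classical_set_scope.
Local Open Scope quotient_scope.
Local Open Scope ring_scope.
Local Open Scope group_scope.

Section Groups.
Variable G : groupType.
Implicit Types (A B H : set G) (x y g : G).

Definition is_subgroup H :=
  H 1 /\ forall x y, H x -> H y -> H (x / y).

(* [generated A] is <A>; [smallest C A] is the intersection of the sets
   satisfying [C] that contain [A]. *)
Definition generated A : set G := smallest is_subgroup A.

(* [A, B], the subgroup generated by the commutators. *)
Definition commutator A B : set G :=
  generated [set g | exists x y, [/\ A x, B y & g = [~ x, y]]].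

Fixpoint lower_central (n : nat) : set G :=
  if n is k.+1 then commutator setT (lower_central k) else setT.

Definition nilpotent_group := exists n, lower_central n = [set 1].

Definition torsion_free := forall g n, (0 < n)%N -> g ^+ n = 1 -> g = 1.

Definition finitely_generated :=
  exists s : seq G, generated [set` s] = setT.

Definition expgz g (k : int) : G :=
  match k with Posz n => g ^+ n | Negz n => g ^- n.+1 end.

Section Malcev.
Variables (m : nat) (a : m.-tuple G).

Definition malcev_word (x : {ffun 'I_m -> int}) : G :=
  \prod_(i < m) expgz (tnth a i) (x i).

(* Indices start at 0: [malcev_tail i] is the subgroup Gamma_(i+1) of the
   1-based notation, and [malcev_tail m] is trivial. *)
Definition malcev_tail (i : nat) : set G :=
  generated [set g | exists j : 'I_m, (i <= j)%N /\ g = tnth a j].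

Definition malcev_basis :=
  (forall g, exists! x : {ffun 'I_m -> int}, g = malcev_word x) /\
  (forall i, (i < m)%N ->
     commutator setT (malcev_tail i) `<=` malcev_tail i.+1).
End Malcev.

Definition hirsch_length (h : nat) :=
  exists a : h.-tuple G, malcev_basis a.

End Groups.

(* Hom(G, Z): [Algebra.to_multiplicative int] is the group (Z, +) written
   multiplicatively; it is convertible to [int]. *)
Notation hom_Z G := {multiplicative G -> Algebra.to_multiplicative int}.

Definition canonical_hom (G : groupType) (m : nat) (a : m.+1.-tuple G)
    (alpha : hom_Z G) :=
  forall x : {ffun 'I_m.+1 -> int}, alpha (malcev_word a x) = x ord0.

Section Kernel.
Variables (G : groupType) (alpha : hom_Z G).

Definition ker_pred : pred G := fun g => (alpha g : int) == 0%R.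

Lemma hom_ZM x y : (alpha (x * y) : int) = ((alpha x : int) + alpha y)%R.
Proof. exact: (@gmulfM _ _ alpha x y). Qed.

Lemma hom_Z1 : (alpha 1 : int) = 0%R.
Proof.
by apply: (@addrI int (alpha 1)); rewrite addr0 -hom_ZM mulg1.
Qed.

Lemma hom_ZV x : (alpha x^-1 : int) = (- (alpha x : int))%R.
Proof.
by apply: (@addrI int (alpha x)); rewrite -hom_ZM mulgV hom_Z1 subrr.
Qed.

Lemma ker_group_closed : group_closed ker_pred.
Proof.
split=> [|x y]; rewrite !unfold_in /ker_pred ?hom_Z1 //.
by move=> /eqP hx /eqP hy; rewrite hom_ZM hom_ZV hx hy subrr.
Qed.

Record kernel := Kernel { ker_val : G; _ : ker_pred ker_val }.

HB.instance Definition _ := [isSub for ker_val].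
HB.instance Definition _ := [Choice of kernel by <:].
HB.instance Definition _ :=
  SubChoice_isSubGroup.Build G ker_pred kernel ker_group_closed.

Definition kappa : {multiplicative kernel -> G} := (val : kernel -> G).

End Kernel.

(* Inhomogeneous cochains with values in the trivial module Z. *)
Section H2.
Variable G : groupType.

Definition is_cocycle2 (s : G -> G -> int) := forall g h k,
  (s h k - s (g * h)%g k + s g (h * k)%g - s g h = 0)%R.

Definition coboundary1 (f : G -> int) : G -> G -> int :=
  fun g h => (f h - f (g * h)%g + f g)%R.

Definition cocycle2_pred : {pred G -> G -> int} := fun s => `[< is_cocycle2 s >].

Lemma cocycle2_zmod_closed : zmod_closed cocycle2_pred.
Proof.
split=> [|s t /asboolP hs /asboolP ht]; apply/asboolP=> g h k.
  by rewrite /= !(subr0, addr0).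
have eq_st u v : (s - t)%R u v = (s u v - t u v)%R by [].
by rewrite -[RHS](subrr 0%R) -{1}(hs g h k) -(ht g h k) !eq_st; ring.
Qed.

HB.instance Definition _ :=
  GRing.isZmodClosed.Build _ cocycle2_pred cocycle2_zmod_closed.

Record Z2 := MkZ2 { Z2_val :> G -> G -> int; Z2_valP : cocycle2_pred Z2_val }.

HB.instance Definition _ := [isSub for Z2_val].
HB.instance Definition _ := [Choice of Z2 by <:].
HB.instance Definition _ := [SubChoice_isSubZmodule of Z2 by <:].

Definition B2 : {pred Z2} :=
  fun s => `[< exists f, Z2_val s = coboundary1 f >].

Lemma B2_zmod_closed : zmod_closed B2.
Proof.
split=> [|s t /asboolP[f hf] /asboolP[f' hf']]; apply/asboolP.
  by exists (fun _ => 0%R); apply/funext=> g; apply/funext=> h.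
exists (fun g => f g - f' g)%R; apply/funext=> g; apply/funext=> h.
have -> : Z2_val (s - t)%R g h = (s g h - t g h)%R by [].
by rewrite hf hf' /coboundary1; ring.
Qed.

HB.instance Definition _ := GRing.isZmodClosed.Build Z2 B2 B2_zmod_closed.

Definition H2 : zmodType := @Quotient.quot Z2 B2.

End H2.

Section Pullback.
Variables (K G : groupType) (f : {multiplicative K -> G}).

Lemma Z2_pull_subproof (s : Z2 G) :
  cocycle2_pred (fun x y => s (f x) (f y)).
Proof.
case: s => s /= /asboolP hs; apply/asboolP => x y z.
by rewrite !(@gmulfM _ _ f) hs.
Qed.

Definition Z2_pull (s : Z2 G) : Z2 K := MkZ2 (Z2_pull_subproof s).

(* The definition picks a representative; [H2_pullE] shows that the choice is
   irrelevant. *)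
Definition H2_pull (c : H2 G) : H2 K := \pi_(H2 K) (Z2_pull (repr c)).

Lemma H2_pullE (s : Z2 G) :
  H2_pull (\pi_(H2 G) s) = \pi_(H2 K) (Z2_pull s).
Proof.
apply/eqP; rewrite -Quotient.idealrBE.
have : (repr (\pi_(H2 G) s) - s)%R \in @B2 G.
  by rewrite Quotient.idealrBE reprK.
move=> /asboolP[b hb]; apply/asboolP; exists (b \o f).
apply/funext => x; apply/funext => y.
have /= := congr1 (fun F => F (f x) (f y)) hb.
by rewrite /coboundary1 /= -(@gmulfM _ _ f).
Qed.

Lemma H2_pull_zmod_morphism : zmod_morphism H2_pull.
Proof.
move=> c d; rewrite -[c]reprK -[d]reprK -raddfB !H2_pullE -raddfB.
by congr (\pi_(H2 K) _); apply: val_inj.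
Qed.

HB.instance Definition _ :=
  GRing.isZmodMorphism.Build (H2 G) (H2 K) H2_pull H2_pull_zmod_morphism.

End Pullback.

Definition skinny (G : groupType) (alpha : hom_Z G) (c : H2 G) :=
  H2_pull (kappa alpha) c = 0%R.

Definition torsion_element (V : zmodType) (v : V) :=
  exists n, (0 < n)%N /\ (v *+ n = 0)%R.

(* Main.v *)
(* Let [N = ker alpha] and let [t] be the first basis element, so that
   [alpha t = 1].  A homomorphism [b : N -> Z] extends to a crossed homomorphism
   [B : Z -> Hom(N, Z)] with [B 1 = b] for the conjugation action of [t], and
   [c g h = B (alpha g) (h t^(- alpha h))] is a cocycle vanishing for [g] in [N].
   If [k c] is the coboundary of [f], then [f] is a homomorphism on [N] and
   [k b x = f x - f (t x t^-1) = - f [t, x]].  So [c] is not torsion as soon as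
   some [x] in [N] has [b x <> 0] while every homomorphism [N -> Z] kills
   [t, x].  Starting from the second basis element, which the second Malcev
   coordinate detects, and iterating commutation with [t], nilpotency makes the
   last detected element such an [x]. *)
Require Import Defs.
From mathcomp Require Import all_boot all_algebra.
From mathcomp Require Import ring.
From mathcomp Require Import boolp classical_sets.

Set Implicit Arguments.
Unset Strict Implicit.
Unset Printing Implicit Defensive.

Import GRing.Theory Num.Theory.
Local Open Scope classical_set_scope.
Local Open Scope group_scope.

(** * Two-sided induction and summation over the integers *)

Lemma int_step_ind (P : int -> Prop) :
  P 0%R -> (forall i, P i <-> P (i + 1)%R) -> forall i, P i.
Proof.
move=> P0 PS; elim/int_ind=> [//|n IHn|n IHn].
  by rewrite -addn1 PoszD; apply: (PS _).1.
by apply: (PS _).2; rewrite -addn1 PoszD opprD subrK.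
Qed.

(** Partial sums, continued to negative indices with a sign. This is what extends a homomorphism on
    the kernel to a crossed homomorphism on the integers. *)
Lemma int_antidifference (u : int -> int) :
  exists U : int -> int, U 0%R = 0%R /\ forall i, U (i + 1)%R = (U i + u i)%R.
Proof.
exists (fun i : int => match i with
  | Posz n => \sum_(k < n) u k
  | Negz n => - \sum_(k < n.+1) u (Negz k) end)%R.
split=> [|[n|[|n]]]; first by rewrite /= big_ord0.
- by rewrite -PoszD addn1 /= big_ord_recr.
- by rewrite /= big_ord0 big_ord1 addNr.
have -> : (Negz n.+1 + 1)%R = Negz n by rewrite !NegzE -addn1 PoszD opprD subrK.
by rewrite [in RHS]big_ord_recr /= opprD subrK.
Qed.

(** * Integer powers and generated subgroups *)

Section Groups.
Variable G : groupType.
Implicit Types (A B H : set G) (g h : G).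

Lemma expgz1 g : expgz g 1%R = g.
Proof. by []. Qed.

Lemma expgzS g (i : int) : expgz g (i + 1)%R = expgz g i * g.
Proof.
case: i => [n|[|n]]; first by rewrite -PoszD addn1 /= expgSr.
  by rewrite /= expg1 mulVg.
have -> : (Negz n.+1 + 1)%R = Negz n by rewrite !NegzE -addn1 PoszD opprD subrK.
by rewrite /= [in RHS]expgS invgM mulgVK.
Qed.

Lemma expgzD g (i j : int) : expgz g (i + j)%R = expgz g i * expgz g j.
Proof.
elim/int_step_ind: j => [|j]; first by rewrite addr0 mulg1.
by rewrite addrA !expgzS mulgA; split=> [->|/mulIg].
Qed.

Lemma expgzN g (i : int) : expgz g (- i)%R = (expgz g i)^-1.
Proof. by apply: (@mulgI _ (expgz g i)); rewrite -expgzD subrr mulgV. Qed.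

Lemma hom_Z_expgz (alpha : hom_Z G) g (i : int) :
  (alpha (expgz g i) : int) = (i * (alpha g : int))%R.
Proof.
elim/int_step_ind: i => [|i]; first by rewrite mul0r /= expg0 hom_Z1.
by rewrite expgzS hom_ZM mulrDl mul1r; split=> [->|/addIr].
Qed.

Lemma subgroupM H x y : is_subgroup H -> H x -> H y -> H (x * y).
Proof.
move=> [H1 HF] Hx Hy; rewrite -[y]invgK; apply: (HF) => //.
by rewrite -div1g; apply: HF.
Qed.

Lemma subgroupV H x : is_subgroup H -> H x -> H x^-1.
Proof. by move=> [H1 HF] Hx; rewrite -div1g; apply: HF. Qed.

Lemma subgroup_expgz H x (i : int) : is_subgroup H -> H x -> H (expgz x i).
Proof.
move=> sH Hx; elim/int_step_ind: i => [|i]; first by case: sH.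
rewrite expgzS; split=> Hi; first exact: subgroupM.
by rewrite -[expgz x i](mulgK x); apply: (sH.2).
Qed.

Lemma generated_subgroup A : is_subgroup (generated A).
Proof.
split=> [H [[H1 _] _] //|x y Ax Ay H HA].
by apply: HA.1.2; [apply: Ax|apply: Ay].
Qed.

Lemma generated_sub A H : is_subgroup H -> A `<=` H -> generated A `<=` H.
Proof. exact: smallest_sub. Qed.

Lemma commutator_comm A B x y : A x -> B y -> commutator A B [~ x, y].
Proof. by move=> Ax By; apply: sub_gen_smallest; exists x, y. Qed.

Lemma prod_ord_first m (F : 'I_m -> G) (i : 'I_m) :
    (forall j : 'I_m, (j < i)%N -> F j = 1) ->
  \prod_(j < m) F j = F i * \prod_(j < m) (if (j <= i)%N then 1 else F j).
Proof.
elim: m F i => [? []//|m IHm] F i F1; rewrite !big_ord_recl.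
case: (unliftP ord0 i) => [k|] ik; last by rewrite ik /= mul1g.
rewrite F1 ?ik // !mul1g (IHm (fun j => F (lift ord0 j)) k); last first.
  by move=> j jk; apply: F1; rewrite ik.
by congr (_ * _); apply: eq_bigr => j _; rewrite /= /bump /= !add1n ltnS.
Qed.

(** * Mal'cev words and the central series of tails *)

Section Malcev.
Variables (m : nat) (a : m.-tuple G).
Implicit Types x y z : {ffun 'I_m -> int}.

Lemma malcev_word_first x (i : 'I_m) :
    (forall j : 'I_m, (j < i)%N -> x j = 0%R) ->
  malcev_word a x = expgz (tnth a i) (x i)
    * malcev_word a [ffun j : 'I_m => if (j <= i)%N then 0%R else x j].
Proof.
move=> x0; rewrite /malcev_word (@prod_ord_first _ _ i) => [|j /x0 -> //].
by congr (_ * _); apply: eq_bigr => j _; rewrite ffunE; case: ifP.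
Qed.

Lemma malcev_word_single (i : 'I_m) (k : int) :
  malcev_word a [ffun j : 'I_m => if j == i then k else 0%R] = expgz (tnth a i) k.
Proof.
rewrite (@malcev_word_first _ i) => [|j ji]; last by rewrite ffunE -val_eqE ltn_eqF.
rewrite ffunE eqxx /malcev_word big1 ?mulg1 // => j _; rewrite !ffunE.
by case: ifP => // /negbT; rewrite -ltnNge => ij; rewrite -val_eqE gtn_eqF.
Qed.

Lemma malcev_tail_gen (i : nat) (j : 'I_m) : (i <= j)%N -> malcev_tail a i (tnth a j).
Proof. by move=> ij; apply: sub_gen_smallest; exists j. Qed.

Lemma malcev_tail_subgroup i : is_subgroup (malcev_tail a i).
Proof. exact: generated_subgroup. Qed.

Lemma malcev_tailS i : malcev_tail a i.+1 `<=` malcev_tail a i.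
Proof.
apply: generated_sub; first exact: malcev_tail_subgroup.
by move=> _ [j [/ltnW ij ->]]; apply: malcev_tail_gen.
Qed.

Lemma malcev_tail_out i g : (m <= i)%N -> malcev_tail a i g -> g = 1.
Proof.
move=> mi; suff: malcev_tail a i `<=` [set 1] by apply.
apply: generated_sub => [|y [j [ij _]]].
  by split=> [//|x y /= -> ->]; rewrite divg1.
by have := leq_trans (leq_trans (ltn_ord j) mi) ij; rewrite ltnn.
Qed.

Lemma malcev_word_tail x (i : nat) :
    (forall j : 'I_m, (j < i)%N -> x j = 0%R) ->
  malcev_tail a i (malcev_word a x).
Proof.
move=> x0; have st := malcev_tail_subgroup i.
rewrite /malcev_word; elim/big_ind: _ => [|g h|j _]; first by case: st.
  exact: subgroupM.
have [/x0 ->|ij] := ltnP j i; first by case: st.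
exact: (subgroup_expgz (x j) st (malcev_tail_gen ij)).
Qed.

Hypothesis basis_a : malcev_basis a.

Lemma malcev_tail_conj i g h : malcev_tail a i g -> malcev_tail a i (g ^ h).
Proof.
(* Centrality is given only for [i < m]; from [m] on the tail is trivial. *)
move=> tg; have [im|mi] := ltnP i m; last first.
  by rewrite (malcev_tail_out mi tg) conj1g -(malcev_tail_out mi tg).
have st := malcev_tail_subgroup i.
have -> : g ^ h = g * [~ h, g]^-1 by rewrite invgR commgEl mulVKg.
apply: (st.2) => //; apply: malcev_tailS; apply: (basis_a.2 i im).
exact: commutator_comm.
Qed.

Lemma malcev_coset_mul (i : nat) (s : G) (k l : int) u v :
    malcev_tail a i u -> malcev_tail a i v ->
  exists2 w, malcev_tail a i w &
    (expgz s k * u) * (expgz s l * v) = expgz s (k + l)%R * w.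
Proof.
move=> tu tv; exists (u ^ expgz s l * v).
  exact: (subgroupM (malcev_tail_subgroup i) (malcev_tail_conj _ tu)).
by rewrite expgzD conjgE !mulgA mulgK.
Qed.

(** The right-hand set contains the generators, and it is a subgroup because the next tail is stable
    under conjugation. *)
Lemma malcev_tail_coset (i : 'I_m) : malcev_tail a i `<=`
  [set g | exists k : int, exists2 w, malcev_tail a i.+1 w &
     g = expgz (tnth a i) k * w].
Proof.
have st := malcev_tail_subgroup i.+1.
apply: generated_sub => [|_ [j [ij ->]]].
  split=> [|x y [k [u tu ->]] [l [v tv ->]]].
    by exists 0%R, 1; [case: st|rewrite mulg1].
  exists (k - l)%R, ((u / v) ^ expgz (tnth a i) (- l)).
    by apply: malcev_tail_conj; apply: st.2.
  by rewrite expgzD conjgE !expgzN invgK invgM !mulgA mulgVK.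
move: ij; rewrite leq_eqVlt => /orP[/eqP/val_inj <-|ij].
  by exists 1%R, 1; [case: st|rewrite mulg1 expgz1].
exists 0%R, (tnth a j); first exact: malcev_tail_gen.
by rewrite mul1g.
Qed.

Lemma malcev_tail_word i g : (i <= m)%N -> malcev_tail a i g ->
  exists2 x : {ffun 'I_m -> int},
    (forall j : 'I_m, (j < i)%N -> x j = 0%R) & g = malcev_word a x.
Proof.
move=> im; move: g; rewrite -(subKn im).
(* Downward induction on [i], starting from the trivial tail at [m]; each step prepends one power of
   a basis element. *)
elim: (m - i)%N (leq_subr i m) => {i im}[_ g|d IHd dm g tg].
  rewrite subn0 => /(malcev_tail_out (leqnn m)) ->.
  exists [ffun=> 0%R] => [j _|]; first by rewrite ffunE.
  by rewrite /malcev_word big1 // => j _; rewrite ffunE.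
have im : (m - d.+1 < m)%N by rewrite -subSn // subSS leq_subr.
have [k [w tw ->]] := @malcev_tail_coset (Ordinal im) g tg.
move: tw; rewrite /= subnSK // => /(IHd (ltnW dm))[x x0 ->].
rewrite -subnSK // in x0.
exists [ffun j => if j == Ordinal im then k else x j] => [j ji|].
  by rewrite ffunE -val_eqE /= ltn_eqF // x0 // ltnW.
rewrite [in RHS](@malcev_word_first _ (Ordinal im)) => [|j ji]; last first.
  by rewrite ffunE -val_eqE /= ltn_eqF // x0 // ltnW.
rewrite ffunE eqxx; congr (_ * malcev_word a _); apply/ffunP => j.
rewrite !ffunE; case: ifP => [ji|]; first by rewrite x0.
by rewrite -val_eqE; case: ltngtP.
Qed.

Lemma malcev_word_inj : injective (malcev_word a).
Proof.
move=> x y xy; have [z [_ zu]] := basis_a.1 (malcev_word a x).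
by rewrite -(zu x) // (zu y).
Qed.

(** Modulo the tail at [i.+1] both words are powers of the same basis element, so their exponents
    add. The remainder is again a word starting after [i], and uniqueness of coordinates identifies
    [z i]. *)
Lemma malcev_mul_leading x y z (i : 'I_m) :
    (forall j : 'I_m, (j < i)%N -> x j = 0%R) ->
    (forall j : 'I_m, (j < i)%N -> y j = 0%R) ->
  malcev_word a x * malcev_word a y = malcev_word a z -> z i = (x i + y i)%R.
Proof.
move=> x0 y0; rewrite (malcev_word_first x0) (malcev_word_first y0).
set u := malcev_word a _; set v := malcev_word a _.
have tu : malcev_tail a i.+1 u.
  by apply: malcev_word_tail => j ji; rewrite ffunE -ltnS ji.
have tv : malcev_tail a i.+1 v.
  by apply: malcev_word_tail => j ji; rewrite ffunE -ltnS ji.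
have [w tw ->] := malcev_coset_mul (tnth a i) (x i) (y i) tu tv.
have [q q0 ->] := malcev_tail_word (ltn_ord i) tw.
pose p := [ffun j => if j == i then x i + y i else q j]%R.
suff -> : expgz (tnth a i) (x i + y i) * malcev_word a q = malcev_word a p.
  by move=> /malcev_word_inj <-; rewrite ffunE eqxx.
rewrite [RHS](@malcev_word_first _ i) => [|j ji]; last first.
  by rewrite ffunE -val_eqE /= ltn_eqF // q0 // ltnW.
rewrite ffunE eqxx; congr (_ * malcev_word a _); apply/ffunP => j.
rewrite !ffunE; case: ifP => [ji|]; first by rewrite q0.
by rewrite -val_eqE; case: ltngtP.
Qed.

End Malcev.
End Groups.

(** Homomorphisms on the kernel are represented by functions on the whole group, with arbitrary
    values elsewhere, so that no coercion from the kernel intervenes. *)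
Definition additive_on_kernel (G : groupType) (alpha : hom_Z G) (b : G -> int) :=
  forall x y, (alpha x : int) = 0%R -> (alpha y : int) = 0%R ->
    b (x * y) = (b x + b y)%R.

(** * The skinny cocycle and its non-torsion criterion *)

Section SkinnyCocycle.
Variables (G : groupType) (alpha : hom_Z G).
Implicit Types (b f : G -> int) (t g h x y : G).

Lemma hom_Z_conjg x g : (alpha (x ^ g) : int) = alpha x.
Proof. by rewrite conjgE !hom_ZM hom_ZV addrCA addNr addr0. Qed.

Lemma additive_on_kernel1 b : additive_on_kernel alpha b -> b 1 = 0%R.
Proof.
by move=> b_add; apply: (@addrI _ (b 1)); rewrite addr0 -b_add ?hom_Z1 ?mulg1.
Qed.

Lemma additive_on_kernelV b x : additive_on_kernel alpha b ->
  (alpha x : int) = 0%R -> b x^-1 = (- b x)%R.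
Proof.
move=> b_add x0; apply: (@addrI _ (b x)); rewrite -b_add ?hom_ZV ?x0 ?oppr0 //.
by rewrite mulgV subrr additive_on_kernel1.
Qed.

Lemma skinny_cocycle_exists t b :
    (alpha t : int) = 1%R -> additive_on_kernel alpha b ->
  exists c : Z2 G, (forall g h, (alpha g : int) = 0%R -> c g h = 0%R) /\
                   (forall x, (alpha x : int) = 0%R -> c t x = b x).
Proof.
move=> t1 b_add; pose tw (j : int) x := x ^ expgz t (- j).
have tw_ker j x : (alpha x : int) = 0%R -> (alpha (tw j x) : int) = 0%R.
  by move=> x0; rewrite hom_Z_conjg.
have twM j x y : tw j (x * y) = tw j x * tw j y by exact: conjMg.
have twD i j x : tw i (tw j x) = tw (i + j)%R x.
  by rewrite /tw -conjgM -expgzD -opprD addrC.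
(* For [i >= 0], [B x i] is the sum of [b (t^k x t^-k)] over [0 <= k < i]. *)
have /choice[B hB] : forall x, exists U : int -> int,
    U 0%R = 0%R /\ forall i, U (i + 1)%R = (U i + b (tw i x))%R.
  by move=> x; apply: int_antidifference.
have B0 x : B x 0%R = 0%R by case: (hB x).
have BS x i : B x (i + 1)%R = (B x i + b (tw i x))%R by case: (hB x).
have BM x y i : (alpha x : int) = 0%R -> (alpha y : int) = 0%R ->
    B (x * y) i = (B x i + B y i)%R.
  move=> x0 y0; elim/int_step_ind: i => [|i]; first by rewrite !B0.
  rewrite !BS twM b_add ?tw_ker // addrACA.
  by split=> [->|/addIr].
(* The crossed homomorphism identity, by induction on [i] with [j] fixed. *)
have BD x i j : B x (i + j)%R = (B (tw j x) i + B x j)%R.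
  elim/int_step_ind: i => [|i]; first by rewrite add0r B0 add0r.
  rewrite addrAC !BS twD [(_ + _ + B x j)%R]addrAC.
  by split=> [->|/addIr].
(* The kernel component in the splitting of the group as the kernel times the powers of [t]. *)
pose rho g := g * expgz t (- (alpha g : int))%R.
have rho_ker g : (alpha (rho g) : int) = 0%R.
  by rewrite hom_ZM hom_Z_expgz t1 mulr1 subrr.
have rhoM g h : rho (g * h) = rho g * tw (alpha g) (rho h).
  by rewrite /rho /tw hom_ZM conjgE opprD addrC expgzD !mulgA mulgK.
have c_cocycle : is_cocycle2 (fun g h => B (rho h) (alpha g)).
  by move=> g h k; rewrite rhoM hom_ZM BD BM ?tw_ker //; ring.
have cP : cocycle2_pred (fun g h => B (rho h) (alpha g)) by apply/asboolP.
exists (MkZ2 cP); split=> [g h /= -> //|x x0 /=].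
have -> : rho x = x by rewrite /rho x0 oppr0 mulg1.
by rewrite t1 -[1%R]add0r BS B0 add0r /tw oppr0 conjg1.
Qed.

Lemma Z2_mulrn (c : Z2 G) n g h : Z2_val (c *+ n)%R g h = (c g h *+ n)%R.
Proof. by elim: n => [//|n IHn]; rewrite !mulrSr -IHn. Qed.

Lemma skinny_class_exists t x b :
    (alpha t : int) = 1%R -> (alpha x : int) = 0%R ->
    additive_on_kernel alpha b -> b x <> 0%R ->
    (forall f, additive_on_kernel alpha f -> f [~ t^-1, x^-1] = 0%R) ->
  exists c : H2 G, skinny alpha c /\ ~ torsion_element c.
Proof.
move=> t1 x0 b_add bx0 f_comm.
have [c [c_ker c_t]] := skinny_cocycle_exists t1 b_add.
exists (\pi_(H2 G) c)%qT; split.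
  rewrite /skinny H2_pullE -[RHS](raddf0 \pi_(H2 (kernel alpha))%qT).
  apply/eqP; rewrite -Quotient.idealrBE subr0; apply/asboolP.
  (* On the kernel the cocycle itself vanishes, so the zero cochain bounds it. *)
  exists (fun _ => 0%R); apply/funext => g; apply/funext => h /=.
  by rewrite c_ker /coboundary1 ?subr0 ?addr0 //; apply/eqP/(valP g).
move=> [n [n_gt0]]; rewrite -raddfMn -[RHS](raddf0 \pi_(H2 G)%qT) => /eqP.
rewrite -Quotient.idealrBE subr0 => /asboolP[f cf].
have {}cf g h : (c g h *+ n = f h - f (g * h)%g + f g)%R.
  by rewrite -Z2_mulrn cf.
(* Only [g] has to lie in the kernel; the last computation takes [h = t]. *)
have f_mul g h : (alpha g : int) = 0%R -> f (g * h) = (f g + f h)%R.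
  move=> g0; have := cf g h; rewrite c_ker // mul0rn addrAC => /esym/eqP.
  by rewrite subr_eq0 addrC => /eqP <-.
have f_add : additive_on_kernel alpha f by move=> g h g0 _; apply: f_mul.
(* Here [[~ t^-1, x^-1]] is [t x t^-1 x^-1], that is, [x ^ t^-1 * x^-1]. *)
have fx : f (x ^ t^-1) = f x.
  apply/eqP; rewrite -subr_eq0 -(additive_on_kernelV f_add x0).
  by rewrite -f_mul ?hom_Z_conjg // -(f_comm f f_add) commgEr invgK.
(* Writing [t * x] as [x ^ t^-1 * t] makes the coboundary at [(t, x)] vanish, so [n] times [b x] is
   zero. *)
have := cf t x; rewrite c_t // conjgCV f_mul ?hom_Z_conjg // fx.
rewrite opprD addrA subrr add0r addNr => /eqP.
by rewrite mulrn_eq0 gtn_eqF // => /eqP.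
Qed.

End SkinnyCocycle.

(** * Descent along the lower central series, and the starting element *)

Section Main.
Variables (G : groupType) (alpha : hom_Z G).

Lemma lower_central_subgroup n : is_subgroup (@lower_central G n).
Proof. by case: n => [|n]; [split|apply: generated_subgroup]. Qed.

Lemma hom_Z_commg x y : (alpha [~ x, y] : int) = 0%R.
Proof. by rewrite commgEl hom_ZM hom_ZV hom_Z_conjg addNr. Qed.

Lemma last_detected_commutator t x b :
    nilpotent_group G -> (alpha x : int) = 0%R ->
    additive_on_kernel alpha b -> b x <> 0%R ->
  exists y b', [/\ (alpha y : int) = 0%R, additive_on_kernel alpha b',
    b' y <> 0%R &
    forall f, additive_on_kernel alpha f -> f [~ t^-1, y^-1] = 0%R].
Proof.
move=> [n lcn].
(* Induction on the distance [d] to the trivial term of the series. The detecting homomorphism is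
   quantified too, since it changes at each step. *)
suff: forall d i, (i + d)%N = n -> forall x b, @lower_central G i x ->
    (alpha x : int) = 0%R -> additive_on_kernel alpha b -> b x <> 0%R ->
  exists y b', [/\ (alpha y : int) = 0%R, additive_on_kernel alpha b',
    b' y <> 0%R &
    forall f, additive_on_kernel alpha f -> f [~ t^-1, y^-1] = 0%R].
  by move=> /(_ n 0 (add0n n)); apply.
elim=> [|d IHd] i; first rewrite addn0 => -> y c.
  by rewrite lcn => /= -> _ /additive_on_kernel1.
rewrite addnS -addSn => id y c lcy y0 c_add cy0.
(* Either [y] is the last detected element, or some [f] detects its commutator with [t^-1], which
   lies one term deeper. *)
have [f0|] := pselect (forall f, additive_on_kernel alpha f ->
    f [~ t^-1, y^-1] = 0%R); first by exists y, c.
move=> /existsNP[f /not_implyP[f_add fR]].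
apply: (IHd _ id [~ t^-1, y^-1] f) => //; last exact: hom_Z_commg.
apply: commutator_comm => //.
by apply: subgroupV lcy; apply: lower_central_subgroup.
Qed.

(** The case of invariance of the Hirsch length that is needed. Two basis elements with images [p]
    and [q] satisfy a power relation, as [p * q = q * p]; uniqueness of coordinates gives [p = 0],
    so by injectivity the first element is trivial, a contradiction. *)
Lemma malcev_size_of_injective_hom n (b : n.-tuple G) :
  injective alpha -> malcev_basis b -> (n <= 1)%N.
Proof.
case: n b => [//|[//|n]] b alpha_inj basis_b.
pose i0 : 'I_n.+2 := ord0; pose i1 : 'I_n.+2 := ord_max.
have word_eq0 i j (k l : int) : i != j ->
    expgz (tnth b i) k = expgz (tnth b j) l -> k = 0%R.
  move=> ij; rewrite -!malcev_word_single => /(malcev_word_inj basis_b)/ffunP.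
  by move=> /(_ i); rewrite !ffunE eqxx (negPf ij).
pose p : int := alpha (tnth b i0); pose q : int := alpha (tnth b i1).
have pq : expgz (tnth b i0) q = expgz (tnth b i1) p.
  by apply: alpha_inj; rewrite !hom_Z_expgz mulrC.
have p0 : p = 0%R by apply: (word_eq0 i1 i0 p q).
have : expgz (tnth b i0) 1%R = expgz (tnth b i1) 0%R.
  by apply: alpha_inj; rewrite !hom_Z_expgz mul1r mul0r.
by move/word_eq0 => /(_ isT).
Qed.

(** * The second Mal'cev coordinate on the kernel *)

Section SecondCoordinate.
Variables (m : nat) (a : m.+1.-tuple G).
Hypotheses (basis_a : malcev_basis a) (alpha_can : canonical_hom a alpha).

Lemma canonical_hom_first : (alpha (tnth a ord0) : int) = 1%R.
Proof. by rewrite -[tnth a _]expgz1 -malcev_word_single alpha_can ffunE eqxx. Qed.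

Lemma canonical_hom_other i : i != ord0 -> (alpha (tnth a i) : int) = 0%R.
Proof.
move=> i0; rewrite -[tnth a i]expgz1 -malcev_word_single alpha_can.
by rewrite ffunE eq_sym (negPf i0).
Qed.

(** On the kernel the first coordinate is zero, so the second one is leading and hence additive. *)
Lemma second_coordinate_additive (i : 'I_m.+1) : i = 1%N :> nat ->
  exists2 b : G -> int, additive_on_kernel alpha b & b (tnth a i) = 1%R.
Proof.
move=> i1.
have /choice[x gx] g : exists x, g = malcev_word a x.
  by have [x [gx _]] := basis_a.1 g; exists x.
have x_ker g (j : 'I_m.+1) : (alpha g : int) = 0%R -> (j < i)%N -> x g j = 0%R.
  rewrite {1}[g]gx alpha_can i1 ltnS leqn0 => <- /eqP j0.
  by congr (x g _); apply: val_inj.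
exists (fun g => x g i) => [g h g0 h0|].
  apply: (malcev_mul_leading basis_a (i := i)) => [j|j|]; try exact: x_ker.
  by rewrite -!gx.
have := gx (tnth a i); rewrite -{1}[tnth a i]expgz1 -malcev_word_single.
by move=> /(malcev_word_inj basis_a) <-; rewrite ffunE eqxx.
Qed.

Lemma canonical_hom_inj : m = 0%N -> injective alpha.
Proof.
move=> m0 g h; have [x [-> _]] := basis_a.1 g; have [y [-> _]] := basis_a.1 h.
rewrite !alpha_can => xy; congr malcev_word; apply/ffunP => j.
suff -> : j = ord0 by [].
by apply: val_inj; case: j => j /=; rewrite m0 ltnS leqn0 => /eqP.
Qed.

End SecondCoordinate.
End Main.

Theorem theorem3p6 (Gamma : groupType)
    (tf : torsion_free Gamma) (fg : finitely_generated Gamma)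
    (nilp : nilpotent_group Gamma)
    (h : nat) (hirsch : hirsch_length Gamma h) (h_ge2 : (2 <= h)%N)
    (alpha : hom_Z Gamma)
    (alpha_can : exists (m : nat) (a : m.+1.-tuple Gamma),
       malcev_basis a /\ canonical_hom a alpha) :
  exists c : H2 Gamma, skinny alpha c /\ ~ torsion_element c.
Proof.
have [m [a [basis_a can_a]]] := alpha_can.
(* The basis defining [alpha] need not be the one witnessing [h]. If it had one element, [alpha]
   would be injective and no basis could have length at least 2. *)
have m_gt0 : (0 < m)%N.
  rewrite lt0n; apply/eqP => /(canonical_hom_inj basis_a can_a) alpha_inj.
  have [b /(malcev_size_of_injective_hom alpha_inj)] := hirsch.
  by rewrite leqNgt h_ge2.
pose i : 'I_m.+1 := Ordinal (m_gt0 : (1 < m.+1)%N).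
have [b b_add bi] :=
  second_coordinate_additive basis_a can_a (erefl : i = 1%N :> nat).
have t1 := canonical_hom_first can_a.
have ai0 := canonical_hom_other can_a (isT : i != ord0).
have [|y [b' [y0 b'_add b'y f0]]] :=
  last_detected_commutator (tnth a ord0) nilp ai0 b_add; first by rewrite bi.
exact: skinny_class_exists t1 y0 b'_add b'y f0.
Qed.
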